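(* Let $\rho$ be a partial assignment and let $C_{\text{reason}}: \sum_{i\in\mathcal{N}} a_i \ell_i \ge b$ be a pseudo-Boolean constraint which propagates the literal $\ell_r$ to $1$ under $\rho$. Let $C'_{\text{reason}}$ and $C''_{\text{reason}}$ be the constraints obtained from $C_{\text{reason}}$ by Division-based reduction and MIR-based reduction, respectively (with respect to $\rho$ and $\ell_r$). Then $C''_{\text{reason}}$ implies $C'_{\text{reason}}$.
   Context: Let $n\in\mathbb{Z}_{>0}$ and $\mathcal{N}=\{1,\dots,n\}$. For $i\in\mathcal{N}$, $x_i$ is a $\{0,1\}$-valued variable, and $\ell_i$ is a literal, which is either $x_i$ or its negation $\overline{x}_i = 1-x_i$. A pseudo-Boolean constraint (in normalized form) is a linear inequality $\sum_{i\in\mathcal{N}} a_i\ell_i\ge b$ with $a_i\in\mathbb{Z}_{\ge 0}$ for all $i\in\mathcal{N}$ and $b\in\mathbb{Z}_{\ge 0}$. A partial assignment $\rho$ is a partial map from variables to $\{0,1\}$, extended to literals by respecting negation. A literal is falsified if $\rho(\ell_i)=0$, satisfied if $\rho(\ell_i)=1$, and unassigned if $\rho$ is undefined on it. Below, ''$\rho(\ell_i)\ne 0$'' means that $\ell_i$ is not falsified, i.e. it is satisfied or unassigned. The slack of $C:\sum_{i\in\mathcal{N}} a_i\ell_i\ge b$ under $\rho$ is $\mathit{slack}(C,\rho)=\sum_{i\in\mathcal{N}:\,\rho(\ell_i)\ne 0}a_i-b$. The constraint $C$ is falsified under $\rho$ iff $\mathit{slack}(C,\rho)<0$. A non-falsified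 constraint $C$ propagates an unassigned literal $\ell_r$ (to $1$) under $\rho$ iff $\mathit{slack}(C,\rho)<a_r$. Weakening a literal $\ell_i$ in $C$ means setting it to $1$: the term $a_i\ell_i$ is removed from the left-hand side and $a_i$ is subtracted from the right-hand side. For real $t$ let $f(t)=t-\lfloor t\rfloor$. For a constraint $\sum_{i} a_i\ell_i\ge b$ with integer data and a divisor $d\in\mathbb{Z}_{>0}$: - The Division cut is $\sum_{i}\lceil a_i/d\rceil\,\ell_i\ge\lceil b/d\rceil$. - The Mixed Integer Rounding (MIR) cut is $$\sum_{i\in I_1}\left\lceil\frac{a_i}{d}\right\rceil\ell_i+\sum_{i\in I_2}\left(\left\lfloor\frac{a_i}{d}\right\rfloor+\frac{f(a_i/d)}{f(b/d)}\right)\ell_i\ge\left\lceil\frac{b}{d}\right\rceil,$$ where $I_1=\{i: f(a_i/d)\ge f(b/d)\text{ or } f(a_i/d)\in\mathbb{Z}\}$ and $I_2=\{i: f(a_i/d)<f(b/d)\text{ and } f(a_i/d)\notin\mathbb{Z}\}$. (If $f(b/d)=0$, then $I_2=\emptyset$ and the second sum is empty.) Division-based reduction (respectively MIR-based reduction) of $C_{\text{reason}}$ with respect to $\rho$ and $\ell_r$ consists of first weakening all literals $\ell_i$ with $i\in W:=\{i\in\mathcal{N}:\rho(\ell_i)\ne 0\text{ and } a_r\nmid a_i\}$ in $C_{\text{reason}}$, and then applying the Division cut (respectively the MIR cut) with divisor $d=a_r$ to the resulting constraint. A constraint $C''$ implies a constraint $C'$ if every assignment of values in $\{0,1\}$ to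 the variables $x_1,\dots,x_n$ that satisfies $C''$ also satisfies $C'$. *)

(* Defs.v *)
From mathcomp Require Import all_boot all_order all_algebra.

Set Implicit Arguments.
Unset Strict Implicit.
Unset Printing Implicit Defensive.

Import Order.TTheory GRing.Theory Num.Theory.
Local Open Scope ring_scope.

(* The linear inequality \sum_i coef i * l_i >= rhs over the variables
   x_0, ..., x_(n-1), where l_i is x_i if neg i = false and 1 - x_i if
   neg i = true.  R is int for constraints with integer data and rat for
   MIR cuts, whose coefficients may be fractional. *)
Record constraint (R : Type) (n : nat) := Constraint {
  coef : 'I_n -> R;
  neg : 'I_n -> bool;
  rhs : R
}.

Definition normalized n (C : constraint int n) : Prop :=
  (forall i, 0 <= coef C i) /\ 0 <= rhs C.

Definition assignment (n : nat) := 'I_n -> bool.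

(* None means that the variable is unassigned. *)
Definition partial_assignment (n : nat) := 'I_n -> option bool.

Definition lit_value R n (C : constraint R n) (x : assignment n) (i : 'I_n) :
  bool := neg C i (+) x i.

Definition lit_pvalue R n (C : constraint R n) (rho : partial_assignment n)
  (i : 'I_n) : option bool := omap (addb (neg C i)) (rho i).

Definition satisfies {R : numDomainType} n (x : assignment n)
    (C : constraint R n) : Prop :=
  rhs C <= \sum_(i < n) coef C i * (lit_value C x i)%:R.

Definition constraint_implies {R S : numDomainType} n
    (C : constraint R n) (D : constraint S n) : Prop :=
  forall x : assignment n, satisfies x C -> satisfies x D.

Definition not_falsified_lit R n (C : constraint R n)
  (rho : partial_assignment n) (i : 'I_n) : bool :=
  lit_pvalue C rho i != Some false.

Definition slack n (C : constraint int n) (rho : partial_assignment n) : int :=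
  (\sum_(i < n | not_falsified_lit C rho i) coef C i) - rhs C.

Definition falsified n (C : constraint int n) (rho : partial_assignment n) :
  bool := slack C rho < 0.

Definition propagates n (C : constraint int n) (rho : partial_assignment n)
    (r : 'I_n) : Prop :=
  [/\ ~~ falsified C rho, lit_pvalue C rho r = None
    & slack C rho < coef C r].

Definition weaken n (W : {set 'I_n}) (C : constraint int n) :
    constraint int n :=
  {| coef := fun i => if i \in W then 0 else coef C i;
     neg := neg C;
     rhs := rhs C - \sum_(i in W) coef C i |}.

(* All arguments of fpart below are quotients of integers, so rat suffices. *)
Definition fpart (t : rat) : rat := t - (Num.floor t)%:~R.

Definition division_cut n (d : int) (C : constraint int n) :
    constraint int n :=
  {| coef := fun i => Num.ceil (((coef C i)%:~R : rat) / d%:~R);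
     neg := neg C;
     rhs := Num.ceil (((rhs C)%:~R : rat) / d%:~R) |}.

(* The "else" branch covers exactly the indices with
   fpart (a_i / d) < fpart (b / d) and fpart (a_i / d) not an integer; the
   denominator fpart (b / d) is then nonzero. *)
Definition mir_cut n (d : int) (C : constraint int n) : constraint rat n :=
  let q (z : int) : rat := z%:~R / d%:~R in
  let fb := fpart (q (rhs C)) in
  {| coef := fun i =>
       let t := q (coef C i) in
       if (fb <= fpart t) || (fpart t \is a Num.int) then (Num.ceil t)%:~R
       else (Num.floor t)%:~R + fpart t / fb;
     neg := neg C;
     rhs := (Num.ceil (q (rhs C)))%:~R |}.

Definition weakened_set n (C : constraint int n) (rho : partial_assignment n)
    (r : 'I_n) : {set 'I_n} :=
  [set i | not_falsified_lit C rho i && ~~ (coef C r %| coef C i)%Z].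

Definition division_reduction n (C : constraint int n)
    (rho : partial_assignment n) (r : 'I_n) : constraint int n :=
  division_cut (coef C r) (weaken (weakened_set C rho r) C).

Definition mir_reduction n (C : constraint int n)
    (rho : partial_assignment n) (r : 'I_n) : constraint rat n :=
  mir_cut (coef C r) (weaken (weakened_set C rho r) C).

(* Main.v *)
Require Import Defs.
From mathcomp Require Import all_boot all_order all_algebra.

(** Both reductions weaken the same literals, so it is enough to compare the two
    cuts of a single constraint.  These have the same literals and the same
    right-hand side, and no coefficient of the MIR cut exceeds the matching
    coefficient of the Division cut ([mir_coef_le_division_coef]): the two differ
    only at a non-integral quotient, where the Division cut adds 1 to the floor
    and the MIR cut adds a ratio of fractional parts that is less than 1.  As
    literals take nonnegative values, enlarging coefficients keeps the constraint
    satisfied. *)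

Import Order.TTheory GRing.Theory Num.Theory.
Local Open Scope ring_scope.

Lemma fpart_ge0 (t : rat) : 0 <= fpart t.
Proof. by rewrite /fpart subr_ge0 floor_le. Qed.

Lemma fpart_int (t : rat) : (fpart t \is a Num.int) = (t \is a Num.int).
Proof. by rewrite /fpart rpredBr // intr_int. Qed.

Lemma floor_add_ratio_le_ceil (t u : rat) :
  t \isn't a Num.int -> fpart t < u ->
  (Num.floor t)%:~R + fpart t / u <= (Num.ceil t)%:~R.
Proof.
move=> tNint lt_tu.
have u_gt0 : 0 < u by apply: le_lt_trans lt_tu; exact: fpart_ge0.
rewrite ceil_floor tNint intrD lerD2l ler_pdivrMr // mul1r.
exact: ltW.
Qed.

Lemma mir_coef_le_division_coef n (d : int) (C : constraint int n) (i : 'I_n) :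
  coef (mir_cut d C) i <= (coef (division_cut d C) i)%:~R.
Proof.
rewrite /=; case: ifP => // /norP[].
rewrite -ltNge fpart_int => lt_fpart tNint.
exact: floor_add_ratio_le_ceil.
Qed.

(** The Division cut has integer data and the MIR cut rational data, so the
    comparison of the two left-hand sides takes place in the rationals. *)
Lemma mir_cut_implies_division_cut n (d : int) (C : constraint int n) :
  constraint_implies (mir_cut d C) (division_cut d C).
Proof.
move=> x; rewrite /satisfies => /le_trans mir_sat.
rewrite -(ler_int rat) rmorph_sum; apply: mir_sat.
apply: ler_sum => i _; rewrite rmorphM /= rmorph_nat.
apply: ler_wpM2r; first exact: ler0n.
exact: mir_coef_le_division_coef.
Qed.

Theorem lemma4 (n : nat) (n_gt0 : (0 < n)%N) (rho : partial_assignment n)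
    (C : constraint int n) (r : 'I_n)
    (C_normalized : normalized C) (C_propagates : propagates C rho r) :
  constraint_implies (mir_reduction C rho r) (division_reduction C rho r).
Proof. exact: mir_cut_implies_division_cut. Qed.
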